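(* Let $M$ be a compact manifold without boundary, $\mathrm{d}$ a metric on $M$ defining its topology, and $f$ a bi-Lipschitz homeomorphism of $(M,\mathrm{d})$ such that $\mathrm{d}$ is $f$-hyperbolic. If $f$ is persistent or has the weak shadowing property, then $f$ is Lipschitz structurally stable: for every $\epsilon>0$ there is $\delta>0$ such that for every bi-Lipschitz homeomorphism $g$ of $(M,\mathrm{d})$ with $\mathrm{d}_L(f,g)<\delta$ there is a homeomorphism $h\colon M\to M$ with $f\circ h=h\circ g$ and $\mathrm{d}_{C^0}(h,\mathrm{id})<\epsilon$.
   Context: A metric $\mathrm{d}$ defining the topology is $f$-hyperbolic if there are $\delta_0>0$, $\lambda>1$ such that $\mathrm{d}(x,y)<\delta_0$ implies $\max\{\mathrm{d}(f(x),f(y)),\mathrm{d}(f^{-1}(x),f^{-1}(y))\}\ge\lambda\,\mathrm{d}(x,y)$. $\mathrm{d}_{C^0}(f,g)=\max_{x}\mathrm{d}(f(x),g(x))+\max_x\mathrm{d}(f^{-1}(x),g^{-1}(x))$; $\mathrm{d}'_L(f,g)=\sup_{x\ne y}\left|\log\frac{\mathrm{d}(f(x),f(y))}{\mathrm{d}(g(x),g(y))}\right|$; $\mathrm{d}_L(f,g)=\mathrm{d}_{C^0}(f,g)+\mathrm{d}'_L(f,g)+\mathrm{d}'_L(f^{-1},g^{-1})$. $f$ has the weak shadowing property if for all $\epsilon>0$ there is $\delta>0$ such that whenever $g$ is a homeomorphism with $\mathrm{d}_{C^0}(f,g)<\delta$, for every $x\in M$ there is $y\in M$ with $\mathrm{d}(f^n(y),g^n(x))<\epsilon$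 for all $n\in\mathbb Z$. $f$ is persistent if for all $\epsilon>0$ there is $\delta>0$ such that whenever $g$ is a homeomorphism with $\mathrm{d}_{C^0}(f,g)<\delta$, for every $x\in M$ there is $y\in M$ with $\mathrm{d}(f^n(x),g^n(y))<\epsilon$ for all $n\in\mathbb Z$. *)

(* Defs.v *)
From Stdlib Require Import Reals ZArith List.
Open Scope R_scope.

Definition is_metric {M : Type} (d : M -> M -> R) : Prop :=
  (forall x y, 0 <= d x y) /\
  (forall x y, d x y = 0 <-> x = y) /\
  (forall x y, d x y = d y x) /\
  (forall x y z, d x z <= d x y + d y z).

Definition is_open {M : Type} (d : M -> M -> R) (U : M -> Prop) : Prop :=
  forall x, U x -> exists r, 0 < r /\ forall y, d x y < r -> U y.

Definition compact_metric {M : Type} (d : M -> M -> R) : Prop :=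
  forall (I : Type) (U : I -> M -> Prop),
    (forall i, is_open d (U i)) -> (forall x, exists i, U i x) ->
    exists l : list I, forall x, exists i, In i l /\ U i x.

Definition continuous_on {M N : Type} (d1 : M -> M -> R) (d2 : N -> N -> R)
  (f : M -> N) (U : M -> Prop) : Prop :=
  forall x, U x -> forall eps, 0 < eps ->
    exists del, 0 < del /\ forall y, U y -> d1 x y < del -> d2 (f x) (f y) < eps.

Definition Rn (n : nat) : Type := { x : nat -> R | forall i, (n <= i)%nat -> x i = 0 }.

Fixpoint sumsq (k : nat) (x y : nat -> R) : R :=
  match k with
  | O => 0
  | S k' => sumsq k' x y + (x k' - y k') ^ 2
  end.

Definition dist_Rn (n : nat) (x y : Rn n) : R :=
  sqrt (sumsq n (proj1_sig x) (proj1_sig y)).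

Definition manifold_without_boundary {M : Type} (d : M -> M -> R) (n : nat) : Prop :=
  forall x : M, exists (U : M -> Prop) (V : Rn n -> Prop) (phi : M -> Rn n) (psi : Rn n -> M),
    U x /\ is_open d U /\ is_open (dist_Rn n) V /\
    (forall y, U y -> V (phi y) /\ psi (phi y) = y) /\
    (forall z, V z -> U (psi z) /\ phi (psi z) = z) /\
    continuous_on d (dist_Rn n) phi U /\
    continuous_on (dist_Rn n) d psi V.

Definition is_homeo {M : Type} (d : M -> M -> R) (f finv : M -> M) : Prop :=
  (forall x, finv (f x) = x) /\ (forall x, f (finv x) = x) /\
  continuous_on d d f (fun _ => True) /\ continuous_on d d finv (fun _ => True).

Definition lipschitz {M : Type} (d : M -> M -> R) (f : M -> M) : Prop :=
  exists L, 0 <= L /\ forall x y, d (f x) (f y) <= L * d x y.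

Definition bi_lipschitz_homeo {M : Type} (d : M -> M -> R) (f finv : M -> M) : Prop :=
  is_homeo d f finv /\ lipschitz d f /\ lipschitz d finv.

Definition iterZ {M : Type} (f finv : M -> M) (n : Z) (x : M) : M :=
  match n with
  | Z0 => x
  | Zpos p => Nat.iter (Pos.to_nat p) f x
  | Zneg p => Nat.iter (Pos.to_nat p) finv x
  end.

(* d_C0(f,g) = max_x d(f x, g x) + max_x d(f^{-1} x, g^{-1} x) < δ ;
   the maxima are expressed as least upper bounds. *)
Definition dC0_lt {M : Type} (d : M -> M -> R) (f finv g ginv : M -> M) (del : R) : Prop :=
  exists a b,
    is_lub (fun r => exists x, r = d (f x) (g x)) a /\
    is_lub (fun r => exists x, r = d (finv x) (ginv x)) b /\
    a + b < del.

Definition logratio_set {M : Type} (d : M -> M -> R) (f g : M -> M) (r : R) : Prop :=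
  exists x y, x <> y /\ r = Rabs (ln (d (f x) (f y) / d (g x) (g y))).

Definition dL_lt {M : Type} (d : M -> M -> R) (f finv g ginv : M -> M) (del : R) : Prop :=
  exists a b c e,
    is_lub (fun r => exists x, r = d (f x) (g x)) a /\
    is_lub (fun r => exists x, r = d (finv x) (ginv x)) b /\
    is_lub (logratio_set d f g) c /\
    is_lub (logratio_set d finv ginv) e /\
    a + b + c + e < del.

Definition f_hyperbolic {M : Type} (d : M -> M -> R) (f finv : M -> M) : Prop :=
  exists del0 lam, 0 < del0 /\ 1 < lam /\
    forall x y, d x y < del0 ->
      Rmax (d (f x) (f y)) (d (finv x) (finv y)) >= lam * d x y.

Definition weak_shadowing {M : Type} (d : M -> M -> R) (f finv : M -> M) : Prop :=
  forall eps, 0 < eps -> exists del, 0 < del /\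
    forall g ginv, is_homeo d g ginv -> dC0_lt d f finv g ginv del ->
      forall x, exists y, forall n : Z, d (iterZ f finv n y) (iterZ g ginv n x) < eps.

Definition persistent {M : Type} (d : M -> M -> R) (f finv : M -> M) : Prop :=
  forall eps, 0 < eps -> exists del, 0 < del /\
    forall g ginv, is_homeo d g ginv -> dC0_lt d f finv g ginv del ->
      forall x, exists y, forall n : Z, d (iterZ f finv n x) (iterZ g ginv n y) < eps.

Definition lipschitz_structurally_stable {M : Type} (d : M -> M -> R) (f finv : M -> M) : Prop :=
  forall eps, 0 < eps -> exists del, 0 < del /\
    forall g ginv, bi_lipschitz_homeo d g ginv -> dL_lt d f finv g ginv del ->
      exists h hinv, is_homeo d h hinv /\
        (forall x, f (h x) = h (g x)) /\
        dC0_lt d h hinv (fun x => x) (fun x => x) eps.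

(* Main.v *)
(** Small bi-Lipschitz perturbations [g] of [f] keep the hyperbolicity inequality,
    hence are expansive with the same constant as [f].  So the relation
    "the [f]-orbit of [y] stays within [e] of the [g]-orbit of [x]" is a closed
    graph that is injective in both variables, and by compactness it defines a
    continuous injection [h] close to the identity that intertwines [f] and [g];
    persistence gives the same with [f] and [g] exchanged.  Only the surjectivity
    of [h] uses the manifold: in a chart it reduces to the Poincare-Miranda
    theorem, whose discrete form is a mod 2 degree computation: over the Kuhn
    simplices of a grid, the cup product of the coboundaries of the sign functions
    does not change when a sign function is altered away from its two faces. *)

From mathcomp Require all_boot all_fingroup zify.
From Stdlib Require Import Reals ZArith List Lra Lia Classical ClassicalEpsilon
  FunctionalExtensionality ProofIrrelevance.
Require Import Defs.
Open Scope R_scope.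

(** * A discrete Poincare-Miranda theorem *)

Module DiscreteMiranda.
Import all_boot all_fingroup zify.
Local Close Scope R_scope.
Set Implicit Arguments.
Unset Strict Implicit.
Unset Printing Implicit Defensive.

(** * Mod 2 cup products of coboundaries on a single simplex *)

Section CupProduct.
Variable X : Type.
Implicit Types (s t : X -> bool) (ss pre post : seq (X -> bool)) (w : nat -> X).

(* [cup [:: s1; ...; sp]] is the mod 2 cochain ds1 \cup ... \cup dsp evaluated on the
   simplex w 0, ..., w p; [cupm pre t post] has the 0-cochain t in the place of dt. *)
Fixpoint cup ss w : bool :=
  if ss is s :: ss' then (s (w 0) (+) s (w 1)) && cup ss' (w \o succn) else true.

Fixpoint cupm pre t post w : bool :=
  if pre is s :: pre' then (s (w 0) (+) s (w 1)) && cupm pre' t post (w \o succn)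
  else t (w 0) && cup post w.

Lemma eq_cup ss w w' :
  (forall i, i <= size ss -> w i = w' i) -> cup ss w = cup ss w'.
Proof.
elim: ss w w' => //= s ss IH w w' ww'.
by rewrite !ww' // (IH _ (w' \o succn)) // => i le_i; rewrite /= ww'.
Qed.

Lemma eq_cupm pre t post w w' :
  (forall i, i <= size pre + size post -> w i = w' i) ->
  cupm pre t post w = cupm pre t post w'.
Proof.
elim: pre w w' => [|s pre IH] w w' ww' /=.
  by rewrite ww' // (eq_cup ww').
rewrite !ww' ?addSn // (IH _ (w' \o succn)) // => i le_i.
by rewrite /= ww' // addSn.
Qed.

Lemma cup_neq s0 ss w : cup ss w ->
  forall i, i < size ss -> nth s0 ss i (w i) != nth s0 ss i (w i.+1).
Proof.
elim: ss w => //= s ss IH w /andP[s01 /IH{}IH] [_|i lt_i] /=.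
  by move: s01; case: (s (w 0)); case: (s (w 1)).
exact: IH.
Qed.

Lemma neq_cup s0 ss w :
  (forall i, i < size ss -> nth s0 ss i (w i) != nth s0 ss i (w i.+1)) ->
  cup ss w.
Proof.
elim: ss w => //= s ss IH w H; apply/andP; split.
  by have /= := H 0 isT; case: (s (w 0)); case: (s (w 1)).
by apply: IH => i lt_i; apply: (H i.+1).
Qed.

Lemma cupm_neq s0 pre t post w : cupm pre t post w ->
  [/\ forall i, i < size pre -> nth s0 pre i (w i) != nth s0 pre i (w i.+1),
      t (w (size pre)) &
      forall i, i < size post ->
        nth s0 post i (w (size pre + i)) != nth s0 post i (w (size pre + i).+1)].
Proof.
elim: pre w => [|s pre IH] w /= /andP[].
  by move=> tw /(@cup_neq s0) H; split.
move=> s01 /IH[H1 H2 H3]; split=> //; case=> [_|i lt_i] /=.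
  by move: s01; case: (s (w 0)); case: (s (w 1)).
exact: H1.
Qed.

(** The Leibniz rule mod 2 for a closed first factor ds. Faces 0 and 1 carry the same value of [G],
    and their factors s1 + s2 and s0 + s2 add up to s0 + s1; every later face keeps the edge from
    [w 0] to [w 1]. *)
Lemma coboundary_cons p s (G : (nat -> X) -> bool) w :
  (forall w w', w =1 w' -> G w = G w') ->
  \big[addb/false]_(j < p.+2) ((s (w (bump j 0)) (+) s (w (bump j 1))) &&
                               G ((w \o bump j) \o succn)) =
  (s (w 0) (+) s (w 1)) &&
    \big[addb/false]_(j < p.+1) G ((w \o succn) \o bump j).
Proof.
move=> eqG; rewrite 2!big_ord_recl [in RHS]big_ord_recl /= addbA andb_addr big_distrr /=.
congr (_ (+) _).
  rewrite (eqG _ ((w \o succn) \o bump 0)) //.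
  rewrite -andb_addl /bump /= !add1n.
  by case: (s (w 0)); case: (s (w 1)); case: (s (w 2)).
apply: eq_bigr => j _; rewrite /bump /= !add0n; congr (_ && _).
by apply: eqG => i /=; congr w; rewrite /bump /= addnS.
Qed.

(** A cup product of closed cochains is closed: the Leibniz rule removes one factor at a time. *)
Lemma coboundary_cup ss w :
  \big[addb/false]_(j < (size ss).+2) cup ss (w \o bump j) = false.
Proof.
elim: ss w => [|s ss IH] w; first by rewrite !big_ord_recl big_ord0.
rewrite (@coboundary_cons _ s (cup ss)) ?IH ?andbF // => w1 w2 w12.
by apply: eq_cup => i _.
Qed.

Lemma coboundary_cupm pre t post w :
  \big[addb/false]_(j < (size pre + size post).+2) cupm pre t post (w \o bump j)
  = cup (pre ++ t :: post) w.
Proof.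
elim: pre w => [|s pre IH] w /=; last first.
  rewrite (@coboundary_cons _ s (cupm pre t post)) ?IH // => w1 w2 w12.
  by apply: eq_cupm => i _.
(* All faces except face 0 keep the vertex [w 0], so [t (w 0)] factors out of their sum [S]. Since
   the product of [post] is closed, [S] equals its value on face 0. *)
have := coboundary_cup post w; rewrite add0n !(@big_ord_recl _ _ _ (size post).+1) /=.
set S := \big[addb/false]_(i < _) _ => E0.
under eq_bigr do rewrite /bump /= -/(bump _).
rewrite -big_distrr /= -/S.
rewrite (@eq_cup post (w \o bump 0) (w \o succn)) // in E0 *.
by move: E0; case: S; case: (cup _ _); case: (t (w 0)); case: (t (w 1)).
Qed.

End CupProduct.

(** * The mod 2 degree over the Kuhn triangulation of a grid *)

Section Grid.
Variables (n k : nat).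
Notation point := {ffun 'I_n -> nat}.
Notation cell := {ffun 'I_n -> 'I_k.+1}.
Implicit Types (v : cell) (tau : 'S_n) (s t : point -> bool) (ss pre post : seq (point -> bool)).

(* [tau a] is the step at which the path from v to v + (1, ..., 1) moves in direction a. *)
Definition kuhn v tau (i : nat) : point := [ffun a => v a + (tau a < i)].

(** For [n] sign functions this is the parity of the number of Kuhn simplices whose i-th edge
    changes the i-th sign for every i, a combinatorial mod 2 degree of the sign map. *)
Definition degree ss : bool :=
  \big[addb/false]_(x : cell * 'S_n) cup ss (kuhn x.1 x.2).

(** Right multiplication by [c] exchanges even and odd permutations, so the two halves of the sum
    agree and cancel mod 2. *)
Lemma addb_involution (G : 'S_n -> bool) (c : 'S_n) :
  odd_perm c -> (forall tau, G (tau * c)%g = G tau) ->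
  \big[addb/false]_tau G tau = false.
Proof.
move=> odd_c Gc; rewrite (bigID (@odd_perm _)) /=.
rewrite (reindex_inj (mulIg c)) /=.
under eq_bigl do rewrite odd_permM odd_c addbT.
under eq_bigr do rewrite Gc.
by rewrite addbb.
Qed.

(** Cells have corners 0, ..., k, so vertices have coordinates up to [k.+1]. The constants on the
    two opposite faces may differ; the coboundary of [s] vanishes on each edge inside one of
    them. *)
Definition constant_on_faces (m : 'I_n) s :=
  forall e (x y : point), e \in [:: 0; k.+1] -> x m = e -> y m = e -> s x = s y.

Definition zero_on_faces (m : 'I_n) s :=
  forall x : point, x m \in [:: 0; k.+1] -> s x = false.

Section Boundary.
Variables (pre post : seq (point -> bool)) (t : point -> bool).
Hypothesis sz : size (pre ++ t :: post) = n.
Hypothesis face : forall m : 'I_n, constant_on_faces m (nth t (pre ++ t :: post) m).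
Hypothesis face_t : forall m : 'I_n, size pre = m -> zero_on_faces m t.

(** If the vertices lie in one face of direction [m], the [m]-th factor vanishes: it is either the
    coboundary of a function constant there or [t] itself, which is zero there. *)
Lemma cupm_face (m : 'I_n) e (w : nat -> point) : e \in [:: 0; k.+1] ->
  (forall i, i < n -> w i m = e) -> cupm pre t post w = false.
Proof.
move=> he wm; apply/negP=> /(@cupm_neq _ t)[H1 H2 H3].
have lmn := ltn_ord m; have szn : n = (size pre + size post).+1.
  by move: sz; rewrite size_cat /=; lia.
have := @face m; rewrite nth_cat; case: (ltngtP m (size pre)) => [lt_m|gt_m|eq_m].
- move=> /(_ e _ _ he) fm; have /eqP := H1 _ lt_m; apply.
  by apply: fm; rewrite wm //; lia.
- rewrite -(subnSK gt_m) /= => /(_ e _ _ he) fm.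
  set q := m - (size pre).+1 in fm *.
  have qm : m = (size pre + q).+1 :> nat by rewrite /q; lia.
  have ltq : q < size post by lia.
  have /eqP := H3 _ ltq; apply.
  by apply: fm; rewrite wm //; lia.
- move=> _; move: H2; rewrite (@face_t m) ?wm ?he //.
  lia.
Qed.

Definition rot_perm : 'S_n := perm (@ord_pred_inj n).

(* Replaces the first vertex v of the path by v + (1, ..., 1), wrapping around at the
   top of the grid, so that face 0 becomes face n; where the wrap-around occurs both
   faces lie in the boundary and contribute nothing. *)
Definition rotate (x : cell * 'S_n) : cell * 'S_n :=
  ([ffun a => if x.2 a == 0 :> nat then ordS (x.1 a) else x.1 a],
   (x.2 * rot_perm)%g).

Lemma rotate_inj : injective rotate.
Proof.
move=> [v tau] [v' tau'] [/ffunP eqv /mulIg eqt]; rewrite -eqt in eqv *.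
congr (_, _); apply/ffunP => a; have := eqv a; rewrite !ffunE /=.
by case: ifP => // _; apply: (@ordS_inj _).
Qed.

Lemma cupm_rotate (x : cell * 'S_n) :
  cupm pre t post (kuhn x.1 x.2 \o bump 0) =
  cupm pre t post (kuhn (rotate x).1 (rotate x).2 \o bump n).
Proof.
case: x => v tau.
have n_gt0 : 0 < n by move: sz; rewrite size_cat /=; lia.
have predE (b : 'I_n) : rot_perm b = (if b == 0 :> nat then n.-1 else b.-1) :> nat.
  rewrite permE /=; case: eqP => [->|/eqP].
    by rewrite modn_small // prednK.
  rewrite -lt0n => b_gt0; rewrite -subn1 -addnBAC // modnDr modn_small ?subn1 //.
  by rewrite (leq_ltn_trans (leq_pred _)).
pose a0 := (tau^-1)%g (Ordinal n_gt0).
have ta0 : tau a0 = Ordinal n_gt0 by rewrite permKV.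
have tau0 a : tau a = 0 :> nat -> a = a0.
  by move=> ta; apply: (@perm_inj _ tau); apply: val_inj; rewrite ta0.
have bn i : i < n -> bump n i = i by rewrite /bump ltnNge => /negbTE->.
have [lt_k|ge_k] := ltnP (v a0) k.
  apply: eq_cupm => i le_i; apply/ffunP => a.
  have lt_i : i < n by move: sz; rewrite size_cat /=; lia.
  rewrite /= bn // !ffunE permM predE /bump /= add1n.
  case: ifP => [/eqP ta|/negbT]; last by rewrite -lt0n => ta; rewrite -[in RHS]ltnS prednK.
  by rewrite (tau0 _ ta) /= ta0 /= modn_small ?ltnS //; lia.
(* The wrap-around case: [a0] is the first direction moved, so the old face lies in the face of
   coordinate [k.+1] and the new one in the face of coordinate 0. *)
have va0 : v a0 = k :> nat by apply/eqP; rewrite eqn_leq ge_k -ltnS ltn_ord.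
rewrite (@cupm_face a0 k.+1) ?(@cupm_face a0 0) ?inE ?eqxx ?orbT // => i lt_i.
  by rewrite /= bn // !ffunE permM predE ta0 /= va0 modnn; lia.
by rewrite !ffunE ta0 va0 addn1.
Qed.

(* An inner face is shared by the two simplices that differ by a transposition. *)
Lemma cupm_swap (j : nat) : 0 < j < n ->
  exists2 c : 'S_n, odd_perm c &
  forall v tau, cupm pre t post (kuhn v (tau * c)%g \o bump j) =
              cupm pre t post (kuhn v tau \o bump j).
Proof.
case/andP=> j_gt0 lt_j.
have lt_j1 : j.-1 < n by rewrite (leq_ltn_trans (leq_pred _)).
exists (tperm (Ordinal lt_j1) (Ordinal lt_j)).
  by rewrite odd_tperm -val_eqE /= neq_ltn prednK // leqnn.
move=> v tau; apply: eq_cupm => i _ /=; apply/ffunP=> a; rewrite !ffunE permM.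
congr (_ + nat_of_bool _); have : bump j i != j by rewrite eq_sym neq_bump.
by case: tpermP => // -> /=; lia.
Qed.

(** A discrete Stokes theorem. The summand is the coboundary of [cupm pre t post], so the degree is
    a sum over faces of simplices: inner faces cancel in pairs by [cupm_swap], and faces 0 and n
    cancel each other through the bijection [rotate]. *)
Lemma degree_boundary : degree (pre ++ t :: post) = false.
Proof.
have szn : n = (size pre + size post).+1 by move: sz; rewrite size_cat /=; lia.
rewrite /degree; under eq_bigr do rewrite -coboundary_cupm.
rewrite exchange_big /= big_ord_recl big_ord_recr /=.
rewrite [X in _ (+) (X (+) _)]big1 ?addFb => [|j _].
  pose F (x : cell * 'S_n) := cupm pre t post (kuhn x.1 x.2 \o bump n).
  transitivity (\big[addb/false]_x F (rotate x) (+) \big[addb/false]_x F x).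
    congr (_ (+) _); apply: eq_bigr => x _; first exact: cupm_rotate.
    by rewrite (_ : bump 0 (size pre + size post) = n) // /bump; lia.
  by rewrite [X in _ (+) X](reindex_inj rotate_inj) addbb.
have [] := @cupm_swap (bump 0 j); first by rewrite /bump /=; have := ltn_ord j; lia.
move=> c odd_c Hc.
rewrite -(pair_big predT predT (fun v tau => cupm pre t post (kuhn v tau \o bump (bump 0 j)))) /=.
by apply: big1 => v _; apply: addb_involution odd_c _ => tau; apply: Hc.
Qed.

End Boundary.

Lemma degree_linear pre s s' post :
  degree (pre ++ s :: post) (+) degree (pre ++ s' :: post) =
  degree (pre ++ (fun x => s x (+) s' x) :: post).
Proof.
rewrite /degree -big_split /=; apply: eq_bigr => x _.
elim: pre (kuhn _ _) => [|r pre IH] w /=; last by rewrite -IH andb_addr.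
rewrite -andb_addl; congr (_ && _).
by case: (s _); case: (s _); case: (s' _); case: (s' _).
Qed.

Definition top_face (m : 'I_n) (x : point) := x m == k.+1.

(** Exactly one simplex contributes. The [m]-th sign changes on edge [m] only if the cell is in the
    last layer of direction [m] and that direction is moved at step [m]; this forces the corner cell
    and the identity permutation. *)
Lemma degree_top_face : degree [seq top_face m | m <- enum 'I_n] = true.
Proof.
move: (enum 'I_n) (size_enum_ord n) (@nth_ord_enum n) => e sze nthe.
pose x0 : cell * 'S_n := ([ffun _ => ord_max], 1%g).
rewrite /degree (bigD1 x0) //= big1 ?addbF => [|x x_neq].
  apply: (@neq_cup _ (fun=> false)) => i; rewrite size_map sze => lt_i.
  rewrite !(nth_map (Ordinal lt_i)) ?sze // (nthe _ (Ordinal lt_i)).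
  by rewrite /top_face !ffunE perm1 /=; lia.
apply: contraNF x_neq => /(@cup_neq _ (fun=> false)) H; case: x H => v tau /= H.
have {}H (m : 'I_n) : v m = k :> nat /\ tau m = m.
  have := H m; rewrite size_map sze => /(_ (ltn_ord m)).
  rewrite !(nth_map m) ?sze // nthe /top_face !ffunE.
  have := ltn_ord (v m).
  by move=> ? ?; split; [lia | apply: val_inj => /=; lia].
apply/eqP; congr (_, _).
  by apply/ffunP => m; apply: val_inj; rewrite ffunE /=; case: (H m).
by apply/permP => m; rewrite perm1; case: (H m).
Qed.

(** The sign functions are replaced by [top_face] one at a time. The mod 2 difference of [s m] and
    [top_face m] vanishes on both faces of direction [m], so by linearity and [degree_boundary] the
    degree does not change. *)
Lemma degree_grid (s : 'I_n -> point -> bool) :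
  (forall m (x : point), x m = 0 -> s m x = false) ->
  (forall m (x : point), x m = k.+1 -> s m x = true) ->
  degree [seq s m | m <- enum 'I_n] = true.
Proof.
move=> s0 s1.
move: (enum 'I_n) (size_enum_ord n) (@nth_ord_enum n) degree_top_face => e sze nthe deg1.
pose mix j := map top_face (take j e) ++ map s (drop j e).
suff mixE j : degree (mix j) = degree (mix 0).
  have := mixE n; rewrite /mix take0 drop0 /= => <-.
  by rewrite take_oversize ?sze // drop_oversize ?sze // cats0 deg1.
elim: j => // j <-.
have [le_nj|lt_jn] := leqP n j.
  by rewrite /mix !take_oversize ?drop_oversize ?sze // ltnW.
pose m0 := Ordinal lt_jn.
rewrite /mix (take_nth m0) ?sze // [drop j e](drop_nth m0) ?sze //.
rewrite map_rcons cat_rcons /= (nthe m0 m0).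
set pre := map _ (take j e); set post := map s (drop _ e).
suff: degree (pre ++ top_face m0 :: post) (+) degree (pre ++ s m0 :: post) = false.
  by case: (degree _); case: (degree _).
have sz_pre : size pre = j by rewrite size_map size_take sze lt_jn.
rewrite degree_linear degree_boundary //.
- by rewrite size_cat /= sz_pre size_map size_drop sze; lia.
- move=> m c x y c_face xm ym; rewrite nth_cat sz_pre.
  case: (ltngtP m j) => [lt_mj|lt_jm|eq_mj].
  + by rewrite (nth_map m0) ?size_take ?sze ?lt_jn // nth_take // nthe /top_face xm ym.
  + rewrite -(subnSK lt_jm) /= (nth_map m0) ?size_drop ?sze; last by have := ltn_ord m; lia.
    rewrite nth_drop subnKC // nthe.
    by move: c_face xm ym; rewrite !inE => /orP[]/eqP->;
       [move=> /s0-> /s0-> | move=> /s1-> /s1->].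
  + have mm0 : m = m0 by apply: val_inj.
    rewrite eq_mj subnn /=; rewrite mm0 in xm ym.
    move: c_face xm ym; rewrite !inE /top_face => c_face.
    by move: c_face => /orP[]/eqP-> xm ym;
       rewrite xm ym ?(s0 _ _ xm) ?(s0 _ _ ym) ?(s1 _ _ xm) ?(s1 _ _ ym).
- move=> m; rewrite sz_pre => jm x; have -> : m = m0 by apply: val_inj.
  by rewrite !inE /top_face => /orP[]/eqP xm; rewrite xm ?(s0 _ _ xm) ?(s1 _ _ xm) ?eqxx.
Qed.

End Grid.

(** An odd degree leaves at least one contributing simplex. Its vertices all belong to one cell, and
    its [m]-th edge supplies both values of [s m]. *)
Lemma discrete_miranda n k (s : 'I_n -> {ffun 'I_n -> nat} -> bool) :
  (forall m (x : {ffun 'I_n -> nat}), x m = 0 -> s m x = false) ->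
  (forall m (x : {ffun 'I_n -> nat}), x m = k.+1 -> s m x = true) ->
  exists v : {ffun 'I_n -> 'I_k.+1}, forall m, exists x y : {ffun 'I_n -> nat},
    [/\ forall a, v a <= x a <= (v a).+1, forall a, v a <= y a <= (v a).+1,
        s m x = false & s m y = true].
Proof.
move=> s0 s1; have := degree_grid s0 s1; rewrite /degree.
case: (pickP (fun x : {ffun 'I_n -> 'I_k.+1} * 'S_n =>
                cup [seq s m | m <- enum 'I_n] (kuhn x.1 x.2))) => [[v tau] /= Hc _|H]; last first.
  by rewrite big1.
exists v => m.
have := cup_neq (fun=> false) Hc; rewrite size_map => /(_ m).
move: (enum 'I_n) (size_enum_ord n) (@nth_ord_enum n) => e sze nthe.
rewrite sze => /(_ (ltn_ord m)); rewrite !(nth_map m) ?sze // nthe => Hm.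
have kb i a : v a <= kuhn v tau i a <= (v a).+1.
  by rewrite ffunE leq_addr -[(v a).+1]addn1 leq_add2l leq_b1.
case E1 : (s m (kuhn v tau m)) Hm; case E2 : (s m (kuhn v tau m.+1)) => // _.
  by exists (kuhn v tau m.+1), (kuhn v tau m).
by exists (kuhn v tau m), (kuhn v tau m.+1).
Qed.

Lemma discrete_miranda_nat n k (s : nat -> (nat -> nat) -> bool) :
  (forall i x, lt i n -> x i = 0 -> s i x = false) ->
  (forall i x, lt i n -> x i = k.+1 -> s i x = true) ->
  exists v : nat -> nat, (forall a, le (v a) k) /\
    forall i, lt i n -> exists x y : nat -> nat,
      (forall a, le (v a) (x a) /\ le (x a) (S (v a))) /\
      (forall a, le (v a) (y a) /\ le (y a) (S (v a))) /\
      s i x = false /\ s i y = true.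
Proof.
move=> s0 s1.
(* Points are padded by 0 beyond the first [n] coordinates, which turns finite functions into
   sequences of naturals. *)
pose ext (x : 'I_n -> nat) i := if insub i is Some a then x a else 0.
have extE x (m : 'I_n) : ext x m = x m by rewrite /ext valK.
have bnd (v x : 'I_n -> nat) : (forall a, v a <= x a <= (v a).+1) ->
    forall a, le (ext v a) (ext x a) /\ le (ext x a) (S (ext v a)).
  move=> vx a; rewrite /ext; case: insubP => [m _ _|_]; last by split; apply/leP.
  by have /andP[/leP ? /leP ?] := vx m.
have [] := @discrete_miranda n k (fun m x => s m (ext x)).
- by move=> m x xm; apply: s0; [apply/ltP; apply: ltn_ord | rewrite extE].
- by move=> m x xm; apply: s1; [apply/ltP; apply: ltn_ord | rewrite extE].
move=> v Hv; exists (ext (fun a => val (v a))); split.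
  move=> a; rewrite /ext; case: insubP => [m _ _|_]; apply/leP => //.
  by rewrite -ltnS ltn_ord.
move=> i /ltP lt_i; have [x [y [vx vy sx sy]]] := Hv (Ordinal lt_i).
by exists (ext x), (ext y); split; [apply: bnd | split; [apply: bnd | split]].
Qed.

End DiscreteMiranda.

(** * The Poincare-Miranda theorem *)

Lemma choice_on {I A : Type} (P : I -> A -> Prop) :
  (forall k, exists a, P k a) -> exists u, forall k, P k (u k).
Proof.
  intros H.
  exists (fun k => proj1_sig (constructive_indefinite_description _ (H k))).
  intros k; exact (proj2_sig (constructive_indefinite_description _ (H k))).
Qed.

Lemma inv_INR_small (e : R) : 0 < e -> exists N, forall k, (N <= k)%nat -> / INR (S k) < e.
Proof.
  intros He. destruct (archimed_cor1 e He) as [N [HN HN0]].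
  exists N. intros k Hk. apply Rle_lt_trans with (/ INR N); [|exact HN].
  apply Rinv_le_contravar; [apply lt_0_INR; lia | apply le_INR; lia].
Qed.

(** The condition [k <= p k] stands for extracting a subsequence: it suffices for passing to limits
    and is stable under composition. *)
Lemma interval_subsequence (u : nat -> R) (a b : R) :
  (forall k, a <= u k <= b) ->
  exists (l : R) (p : nat -> nat), a <= l <= b /\ (forall k, (k <= p k)%nat) /\
    Un_cv (fun k => u (p k)) l.
Proof.
  intros Hu.
  destruct (Bolzano_Weierstrass u (fun c => a <= c <= b) (compact_P3 a b) Hu) as [l Hl].
  assert (Hch : forall k, exists p, (k <= p)%nat /\ R_dist (u p) l < / INR (S k)).
  { intros k.
    assert (H0 : 0 < / INR (S k)) by (apply Rinv_0_lt_compat, lt_0_INR; lia).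
    destruct (Hl (disc l (mkposreal _ H0)) k) as [p [Hp Hd]].
    - exists (mkposreal _ H0); intros y Hy; exact Hy.
    - exists p; split; [exact Hp | exact Hd]. }
  destruct (choice_on _ Hch) as [p Hp].
  assert (Hcv : Un_cv (fun k => u (p k)) l).
  { intros e He. destruct (inv_INR_small e He) as [N HN].
    exists N; intros k Hk. apply Rlt_trans with (/ INR (S k)); [apply Hp | apply HN; lia]. }
  exists l, p; split; [|split; [intros k; apply Hp | exact Hcv]].
  split; apply Rnot_lt_le; intros Hlt.
  - destruct (Hcv (a - l)) as [N HN]; [lra|].
    specialize (HN N (le_n _)); unfold R_dist in HN. apply Rabs_def2 in HN.
    specialize (Hu (p N)); lra.
  - destruct (Hcv (l - b)) as [N HN]; [lra|].
    specialize (HN N (le_n _)); unfold R_dist in HN. apply Rabs_def2 in HN.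
    specialize (Hu (p N)); lra.
Qed.

Lemma Un_cv_reindex (u : nat -> R) (l : R) (p : nat -> nat) :
  (forall k, (k <= p k)%nat) -> Un_cv u l -> Un_cv (fun k => u (p k)) l.
Proof.
  intros Hp Hu e He. destruct (Hu e He) as [N HN]. exists N; intros k Hk.
  apply HN. specialize (Hp k); lia.
Qed.

Lemma box_subsequence (n : nat) (z : nat -> nat -> R) (a b : nat -> R) :
  (forall k i, (i < n)%nat -> a i <= z k i <= b i) ->
  exists (l : nat -> R) (p : nat -> nat), (forall k, (k <= p k)%nat) /\
    forall i, (i < n)%nat -> a i <= l i <= b i /\ Un_cv (fun k => z (p k) i) (l i).
Proof.
  induction n as [|n IH]; intros Hz.
  - exists (fun _ => 0), (fun k => k); split; intros; lia.
  - destruct IH as [l [p [Hp Hl]]]; [intros; apply Hz; lia|].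
    destruct (interval_subsequence (fun k => z (p k) n) (a n) (b n)) as [c [q [Hc [Hq Hcv]]]].
    { intros k; apply Hz; lia. }
    exists (fun i => if Nat.eq_dec i n then c else l i), (fun k => p (q k)); split.
    + intros k; specialize (Hp (q k)); specialize (Hq k); lia.
    + intros i Hi; destruct (Nat.eq_dec i n) as [->|Hne]; [split; assumption|].
      destruct (Hl i) as [H1 H2]; [lia|]. split; [exact H1|].
      apply (Un_cv_reindex (fun k => z (p k) i)); assumption.
Qed.

Notation "z @ i" := (proj1_sig z i) (at level 20).

Lemma sumsq_coord (n : nat) (x y : nat -> R) (i : nat) :
  (i < n)%nat -> (x i - y i) ^ 2 <= sumsq n x y.
Proof.
  assert (Hpos : forall m, 0 <= sumsq m x y).
  { induction m as [|m IH]; simpl; [lra|]. pose proof (pow2_ge_0 (x m - y m)); simpl in *; lra. }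
  induction n as [|n IH]; intros Hi; [lia|]. simpl.
  destruct (Nat.eq_dec i n) as [->|Hne].
  - specialize (Hpos n); simpl in *; lra.
  - specialize (IH ltac:(lia)). pose proof (pow2_ge_0 (x n - y n)); simpl in *; lra.
Qed.

Lemma coord_le_dist_Rn (n : nat) (x y : Rn n) (i : nat) :
  (i < n)%nat -> Rabs (x @ i - y @ i) <= dist_Rn n x y.
Proof.
  intros Hi. unfold dist_Rn. rewrite <- sqrt_Rsqr_abs.
  apply sqrt_le_1_alt. rewrite Rsqr_pow2. apply (sumsq_coord n); exact Hi.
Qed.

Lemma coord_dist_Rn_lt (n : nat) (x y : Rn n) (i : nat) (e : R) :
  (i < n)%nat -> dist_Rn n x y < e -> - e < x @ i - y @ i < e.
Proof.
  intros Hi H. destruct (Rabs_def2 (x @ i - y @ i) e); [|split; assumption].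
  eapply Rle_lt_trans; [apply coord_le_dist_Rn, Hi | exact H].
Qed.

Lemma dist_Rn_le (n : nat) (x y : Rn n) (e : R) : 0 <= e ->
  (forall i, (i < n)%nat -> Rabs (x @ i - y @ i) <= e) -> dist_Rn n x y <= INR n * e.
Proof.
  intros He H. unfold dist_Rn.
  assert (Hs : forall m, (m <= n)%nat -> sumsq m (proj1_sig x) (proj1_sig y) <= (INR m * e) ^ 2).
  { induction m as [|m IH]; intros Hm; [simpl; lra|].
    specialize (IH ltac:(lia)). specialize (H m ltac:(lia)).
    cbn [sumsq]. rewrite S_INR. pose proof (pos_INR m).
    rewrite <- (pow2_abs (x @ m - y @ m)).
    assert (Rabs (x @ m - y @ m) ^ 2 <= e ^ 2) by (apply pow_incr; split; [apply Rabs_pos | exact H]).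
    assert (0 <= INR m * e * e) by (apply Rmult_le_pos; [apply Rmult_le_pos|]; assumption).
    nra. }
  rewrite <- (sqrt_pow2 (INR n * e)); [|apply Rmult_le_pos; [apply pos_INR | exact He]].
  apply sqrt_le_1_alt, Hs; lia.
Qed.

Lemma dist_Rn_cv (n : nat) (z : nat -> Rn n) (l : Rn n) :
  (forall i, (i < n)%nat -> Un_cv (fun k => z k @ i) (l @ i)) ->
  forall e, 0 < e -> exists N, forall k, (N <= k)%nat -> dist_Rn n l (z k) < e.
Proof.
  intros Hcv e He.
  (* The added 1 keeps the divisor positive for [n = 0] and makes [INR n * e'] smaller than [e]. *)
  set (e' := e / (INR n + 1)).
  assert (Hn : 0 < INR n + 1) by (pose proof (pos_INR n); lra).
  assert (He' : 0 < e') by (apply Rdiv_lt_0_compat; assumption).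
  assert (H : forall m, (m <= n)%nat -> exists N, forall k, (N <= k)%nat ->
             forall i, (i < m)%nat -> Rabs (l @ i - z k @ i) <= e').
  { induction m as [|m IH]; intros Hm; [exists 0%nat; intros; lia|].
    destruct (IH ltac:(lia)) as [N HN]. destruct (Hcv m ltac:(lia) e' He') as [N' HN'].
    exists (max N N'); intros k Hk i Hi. destruct (Nat.eq_dec i m) as [->|Hne].
    - left; rewrite Rabs_minus_sym; apply HN'; lia.
    - apply HN; lia. }
  destruct (H n (le_n _)) as [N HN]. exists N; intros k Hk.
  apply Rle_lt_trans with (INR n * e'); [apply dist_Rn_le; [lra | exact (HN k Hk)]|].
  replace e with ((INR n + 1) * e') by (unfold e'; field; lra). nra.
Qed.

Lemma Rn_ext (n : nat) (x y : Rn n) : (forall i, (i < n)%nat -> x @ i = y @ i) -> x = y.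
Proof.
  intros H. destruct x as [x Hx], y as [y Hy]; simpl in H.
  assert (E : x = y).
  { apply functional_extensionality; intros i. destruct (Nat.lt_ge_cases i n) as [Hi|Hi];
      [apply H, Hi | rewrite Hx, Hy; trivial]. }
  subst y. f_equal. apply proof_irrelevance.
Qed.

Definition cut_Rn (n : nat) (u : nat -> R) : Rn n.
Proof.
  exists (fun i => if le_lt_dec n i then 0 else u i).
  intros i Hi; destruct (le_lt_dec n i); [reflexivity | lia].
Defined.

Lemma cut_Rn_coord (n : nat) (u : nat -> R) (i : nat) : (i < n)%nat -> cut_Rn n u @ i = u i.
Proof. intros Hi; simpl; destruct (le_lt_dec n i); [lia | reflexivity]. Qed.

Definition box (n : nat) (c : Rn n) (r : R) (z : Rn n) : Prop :=
  forall i, (i < n)%nat -> c @ i - r <= z @ i <= c @ i + r.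

Lemma box_subsequence_Rn (n : nat) (c : Rn n) (r : R) (z : nat -> Rn n) :
  (forall k, box n c r (z k)) ->
  exists (l : Rn n) (p : nat -> nat), box n c r l /\ (forall k, (k <= p k)%nat) /\
    forall e, 0 < e -> exists N, forall k, (N <= k)%nat -> dist_Rn n l (z (p k)) < e.
Proof.
  intros Hz.
  destruct (box_subsequence n (fun k => proj1_sig (z k)) (fun i => c @ i - r) (fun i => c @ i + r))
    as [l [p [Hp Hl]]].
  { intros k i Hi; apply Hz, Hi. }
  exists (cut_Rn n l), p; split; [|split; [exact Hp|]].
  - intros i Hi; rewrite cut_Rn_coord by exact Hi; apply Hl, Hi.
  - apply (dist_Rn_cv n (fun k => z (p k))).
    intros i Hi; rewrite cut_Rn_coord by exact Hi; apply Hl, Hi.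
Qed.

Section PoincareMiranda.
Variables (n : nat) (c q : Rn n) (r : R) (F : Rn n -> Rn n).
Hypothesis r_pos : 0 < r.
Hypothesis F_low : forall z i, (i < n)%nat -> box n c r z -> z @ i = c @ i - r -> F z @ i < q @ i.
Hypothesis F_high : forall z i, (i < n)%nat -> box n c r z -> z @ i = c @ i + r -> q @ i < F z @ i.

(* The truncation keeps the point in the box for every [x]. *)
Definition grid_point (k : nat) (x : nat -> nat) : Rn n :=
  cut_Rn n (fun i => c @ i - r + 2 * r / INR (S k) * INR (Nat.min (x i) (S k))).

Lemma grid_point_box (k : nat) (x : nat -> nat) : box n c r (grid_point k x).
Proof.
  intros i Hi. unfold grid_point; rewrite cut_Rn_coord by exact Hi.
  assert (Hk : 0 < INR (S k)) by (apply lt_0_INR; lia).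
  assert (Hx : 0 <= INR (Nat.min (x i) (S k)) <= INR (S k)).
  { split; [apply pos_INR | apply le_INR; lia]. }
  set (w := 2 * r / INR (S k)).
  assert (Hw : 2 * r = w * INR (S k)) by (unfold w; field; lra).
  assert (0 < w) by (apply Rdiv_lt_0_compat; lra). nra.
Qed.

(** The discrete theorem is applied to the signs of [F z @ i - q @ i] at the grid points; [F_low]
    and [F_high] fix these signs on the faces of the box. *)
Lemma grid_cell (k : nat) : exists z, box n c r z /\
  forall i, (i < n)%nat -> exists x y, box n c r x /\ box n c r y /\
    (forall a, (a < n)%nat -> Rabs (x @ a - z @ a) <= 2 * r * / INR (S k)) /\
    (forall a, (a < n)%nat -> Rabs (y @ a - z @ a) <= 2 * r * / INR (S k)) /\
    F x @ i <= q @ i <= F y @ i.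
Proof.
  assert (Hk : 0 < INR (S k)) by (apply lt_0_INR; lia).
  destruct (@DiscreteMiranda.discrete_miranda_nat n k
    (fun i x => if Rlt_dec (q @ i) (F (grid_point k x) @ i) then true else false))
    as [v [Hv Hcell]].
  - intros i x Hi Hx. destruct (Rlt_dec _ _) as [Hlt|]; [|reflexivity].
    exfalso; apply (Rlt_asym _ _ Hlt), F_low; [exact Hi | apply grid_point_box|].
    unfold grid_point; rewrite cut_Rn_coord, Hx by exact Hi.
    rewrite Nat.min_0_l; simpl INR; ring.
  - intros i x Hi Hx. destruct (Rlt_dec _ _) as [|Hn]; [reflexivity|].
    exfalso; apply Hn, F_high; [exact Hi | apply grid_point_box|].
    unfold grid_point; rewrite cut_Rn_coord, Hx by exact Hi.
    rewrite Nat.min_id; field; lra.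
  - exists (grid_point k v); split; [apply grid_point_box|].
    assert (Hclose : forall x, (forall a, (v a <= x a)%nat /\ (x a <= S (v a))%nat) ->
      forall a, (a < n)%nat ->
        Rabs (grid_point k x @ a - grid_point k v @ a) <= 2 * r * / INR (S k)).
    { intros x Hx a Ha. unfold grid_point; rewrite !cut_Rn_coord by exact Ha.
      specialize (Hv a); specialize (Hx a).
      rewrite !Nat.min_l by lia.
      assert (Hvx : INR (v a) <= INR (x a) <= INR (v a) + 1).
      { rewrite <- S_INR; split; apply le_INR; lia. }
      assert (0 < 2 * r / INR (S k)) by (apply Rdiv_lt_0_compat; lra).
      fold (2 * r / INR (S k)). apply Rabs_le; nra. }
    intros i Hi. destruct (Hcell i Hi) as [x [y [Hx [Hy [Hsx Hsy]]]]].
    exists (grid_point k x), (grid_point k y).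
    do 2 (split; [apply grid_point_box|]).
    do 2 (split; [apply Hclose; assumption|]).
    destruct (Rlt_dec _ (F (grid_point k x) @ i)); [discriminate|].
    destruct (Rlt_dec _ (F (grid_point k y) @ i)); [|discriminate]. lra.
Qed.

(** As the mesh tends to 0, the cell corners accumulate at some [l]. Arbitrarily close to [l], each
    coordinate of [F] takes values on both sides of that of [q], so continuity forces equality at
    [l]. *)
Lemma poincare_miranda :
  continuous_on (dist_Rn n) (dist_Rn n) F (box n c r) -> exists z, box n c r z /\ F z = q.
Proof.
  intros Hcont. destruct (choice_on _ grid_cell) as [z Hz].
  destruct (box_subsequence_Rn n c r z (fun k => proj1 (Hz k))) as [l [p [Hl [Hp Hcv]]]].
  exists l; split; [exact Hl|]. apply Rn_ext; intros i Hi.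
  assert (Hnear : forall e, 0 < e -> exists x y, box n c r x /\ box n c r y /\
    dist_Rn n l x < e /\ dist_Rn n l y < e /\ F x @ i <= q @ i <= F y @ i).
  { intros e He. set (e' := e / (INR n + 1)).
    assert (Hn : 0 < INR n + 1) by (pose proof (pos_INR n); lra).
    assert (He' : 0 < e') by (apply Rdiv_lt_0_compat; assumption).
    destruct (Hcv (e' / 2)) as [N1 HN1]; [lra|].
    destruct (inv_INR_small (e' / 2 / (2 * r))) as [N2 HN2].
    { repeat apply Rdiv_lt_0_compat; lra. }
    set (k := Nat.max N1 N2).
    specialize (HN1 k ltac:(lia)). specialize (HN2 (p k) ltac:(specialize (Hp k); lia)).
    assert (Hm : 2 * r * / INR (S (p k)) < e' / 2).
    { replace (e' / 2) with (2 * r * (e' / 2 / (2 * r))) by (field; lra).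
      apply Rmult_lt_compat_l; lra. }
    destruct (proj2 (Hz (p k)) i Hi) as [x [y [Hx [Hy [Hxz [Hyz Hs]]]]]].
    exists x, y. do 2 (split; [assumption|]).
    assert (Hd : forall w, (forall a, (a < n)%nat ->
        Rabs (w @ a - z (p k) @ a) <= 2 * r * / INR (S (p k))) -> dist_Rn n l w < e).
    { intros w Hw. apply Rle_lt_trans with (INR n * e').
      - apply dist_Rn_le; [lra|]. intros a Ha. specialize (Hw a Ha).
        pose proof (coord_le_dist_Rn n l (z (p k)) a Ha).
        replace (l @ a - w @ a) with ((l @ a - z (p k) @ a) - (w @ a - z (p k) @ a)) by ring.
        eapply Rle_trans; [apply Rabs_triang|]. rewrite Rabs_Ropp. lra.
      - replace e with ((INR n + 1) * e') by (unfold e'; field; lra). nra. }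
    do 2 (split; [apply Hd; assumption|]). exact Hs. }
  destruct (Req_dec (F l @ i) (q @ i)) as [E|Hne]; [exact E|]. exfalso.
  destruct (Hcont l Hl (Rabs (F l @ i - q @ i))) as [del [Hdel HF]].
  { apply Rabs_pos_lt; lra. }
  destruct (Hnear del Hdel) as [x [y [Hx [Hy [Hlx [Hly Hs]]]]]].
  specialize (HF x Hx Hlx) as HFx; specialize (HF y Hy Hly) as HFy.
  pose proof (coord_le_dist_Rn n (F l) (F x) i Hi) as H1.
  pose proof (coord_le_dist_Rn n (F l) (F y) i Hi) as H2.
  unfold Rabs in *; repeat destruct (Rcase_abs _); lra.
Qed.

End PoincareMiranda.

(** * Compactness arguments, charts, and surjectivity of maps close to the identity *)

Lemma compact_uniform {M : Type} (d : M -> M -> R) (P : R -> M -> Prop) :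
  is_metric d -> compact_metric d ->
  (forall r r' y, 0 < r' <= r -> P r y -> P r' y) ->
  (forall x, exists r s, 0 < r /\ 0 < s /\ forall y, d x y < s -> P r y) ->
  exists r, 0 < r /\ forall y, P r y.
Proof.
  intros [_ [Hd0 [_ Htri]]] Hcpt Hmono Hloc.
  (* The set indexed by a radius is the interior of the set where [P] holds with it, hence open.
     Monotonicity lets the least radius of a finite subcover serve everywhere. *)
  set (U := fun (i : {r : R | 0 < r}) x => exists s, 0 < s /\ forall y, d x y < s -> P (proj1_sig i) y).
  destruct (Hcpt _ U) as [l Hl].
  - intros i x [s [Hs HP]]. exists (s / 2); split; [lra|].
    intros y Hy. exists (s / 2); split; [lra|]. intros z Hz. apply HP.
    specialize (Htri x y z); lra.
  - intros x. destruct (Hloc x) as [r [s [Hr [Hs HP]]]].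
    exists (exist _ r Hr), s; split; assumption.
  - assert (Hmin : exists r, 0 < r /\ forall i, In i l -> r <= proj1_sig i).
    { clear. induction l as [|[a Ha] l [r [Hr Hmin]]].
      - exists 1; split; [lra | intros i []].
      - exists (Rmin a r); split; [apply Rmin_pos; assumption|].
        intros i [<-|Hi]; [apply Rmin_l | eapply Rle_trans; [apply Rmin_r | apply Hmin, Hi]]. }
    destruct Hmin as [r [Hr Hmin]]. exists r; split; [exact Hr|]. intros y.
    destruct (Hl y) as [i [Hi [s [Hs HP]]]].
    apply (Hmono (proj1_sig i)); [split; [exact Hr | apply Hmin, Hi]|].
    apply HP. rewrite (proj2 (Hd0 y y) eq_refl); exact Hs.
Qed.

(** Used to see a map close to the identity as one close to the identity in the chart, uniformly
    over the box. Otherwise there are counterexamples at distance below [/ INR (S k)], and a limit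
    point [l] of their box points contradicts continuity of [phi] at [psi l]. *)
Lemma chart_modulus {M : Type} (d : M -> M -> R) (n : nat) (U : M -> Prop) (V : Rn n -> Prop)
    (phi : M -> Rn n) (psi : Rn n -> M) (c : Rn n) (r e : R) :
  is_metric d -> is_open d U ->
  (forall z, V z -> U (psi z) /\ phi (psi z) = z) ->
  continuous_on d (dist_Rn n) phi U -> continuous_on (dist_Rn n) d psi V ->
  (forall z, box n c r z -> V z) -> 0 < e ->
  exists del, 0 < del /\ forall z y, box n c r z -> d y (psi z) < del ->
    U y /\ forall i, (i < n)%nat -> Rabs (phi y @ i - z @ i) < e.
Proof.
  intros [Hpos [Hd0 [Hsym Htri]]] HU Hpsi Cphi Cpsi HV He. apply NNPP; intros Hno.
  assert (Hbad : forall k, exists zy : Rn n * M, box n c r (fst zy) /\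
    d (snd zy) (psi (fst zy)) < / INR (S k) /\
    ~ (U (snd zy) /\ forall i, (i < n)%nat -> Rabs (phi (snd zy) @ i - fst zy @ i) < e)).
  { intros k. apply NNPP; intros Hk. apply Hno. exists (/ INR (S k)); split.
    - apply Rinv_0_lt_compat, lt_0_INR; lia.
    - intros z y Hz Hy. apply NNPP; intros Hc. apply Hk. exists (z, y); auto. }
  destruct (choice_on _ Hbad) as [zy Hzy].
  destruct (box_subsequence_Rn n c r (fun k => fst (zy k)) (fun k => proj1 (Hzy k)))
    as [l [p [Hl [Hp Hcv]]]].
  destruct (Hpsi l (HV l Hl)) as [HUl Hphil].
  destruct (HU _ HUl) as [r1 [Hr1 HUr]].
  destruct (Cphi _ HUl (e / 2)) as [r2 [Hr2 Hphi]]; [lra|].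
  set (r3 := Rmin r1 r2).
  assert (Hr3 : 0 < r3) by (apply Rmin_pos; assumption).
  destruct (Cpsi l (HV l Hl) (r3 / 2)) as [r4 [Hr4 Hpsi4]]; [lra|].
  destruct (Hcv (Rmin r4 (e / 2))) as [N1 HN1]; [apply Rmin_pos; lra|].
  destruct (inv_INR_small (r3 / 2)) as [N2 HN2]; [lra|].
  set (k := Nat.max N1 N2).
  specialize (HN1 k ltac:(lia)). specialize (HN2 (p k) ltac:(specialize (Hp k); lia)).
  destruct (Hzy (p k)) as [Hz [Hy Hc]]. destruct (zy (p k)) as [z y]; simpl in *.
  assert (Hz4 : d (psi l) (psi z) < r3 / 2).
  { apply Hpsi4; [apply HV, Hz|]. eapply Rlt_le_trans; [exact HN1 | apply Rmin_l]. }
  assert (Hy3 : d (psi l) y < r3).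
  { specialize (Htri (psi l) (psi z) y). rewrite (Hsym (psi z) y) in Htri. lra. }
  assert (HUy : U y) by (apply HUr; eapply Rlt_le_trans; [exact Hy3 | apply Rmin_l]).
  apply Hc; split; [exact HUy|]. intros i Hi.
  assert (H1 : dist_Rn n (phi (psi l)) (phi y) < e / 2).
  { apply Hphi; [exact HUy | eapply Rlt_le_trans; [exact Hy3 | apply Rmin_r]]. }
  rewrite Hphil in H1.
  assert (H2 : dist_Rn n l z < e / 2) by (eapply Rlt_le_trans; [exact HN1 | apply Rmin_r]).
  pose proof (coord_dist_Rn_lt n _ _ i _ Hi H1).
  pose proof (coord_dist_Rn_lt n _ _ i _ Hi H2).
  apply Rabs_def1; lra.
Qed.

Lemma box_subset_ball (n : nat) (c : Rn n) (rho : R) : 0 < rho ->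
  exists r, 0 < r /\ forall z, box n c r z -> dist_Rn n c z < rho.
Proof.
  intros Hrho. assert (Hn : 0 < INR n + 1) by (pose proof (pos_INR n); lra).
  exists (rho / (INR n + 1)). assert (Hr : 0 < rho / (INR n + 1)) by (apply Rdiv_lt_0_compat; lra).
  split; [exact Hr|]. intros z Hz.
  apply Rle_lt_trans with (INR n * (rho / (INR n + 1))).
  - apply dist_Rn_le; [lra|]. intros i Hi; specialize (Hz i Hi). apply Rabs_le; lra.
  - replace rho with ((INR n + 1) * (rho / (INR n + 1))) at 2 by (field; lra). nra.
Qed.

(** Near each point, Poincare-Miranda applied to [h] read in a chart yields preimages of all nearby
    points; compactness makes the admissible displacement uniform. *)
Lemma near_identity_surjective {M : Type} (d : M -> M -> R) (n : nat) :
  is_metric d -> compact_metric d -> manifold_without_boundary d n ->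
  exists e, 0 < e /\ forall h, continuous_on d d h (fun _ => True) ->
    (forall x, d (h x) x < e) -> forall y, exists x, h x = y.
Proof.
  intros Hm Hcpt Hman.
  destruct (compact_uniform d (fun e q => forall h, continuous_on d d h (fun _ => True) ->
    (forall x, d (h x) x < e) -> exists x, h x = q)) as [e [He HP]]; try assumption.
  - intros r r' y Hr HP h Ch Hh. apply HP; [exact Ch|]. intros x; specialize (Hh x); lra.
  - intros p. destruct (Hman p) as [U [V [phi [psi [HUp [HU [HV [Hphi [Hpsi [Cphi Cpsi]]]]]]]]]].
    destruct (Hphi p HUp) as [HVp _].
    destruct (HV _ HVp) as [rho [Hrho HVrho]].
    destruct (box_subset_ball n (phi p) rho Hrho) as [r [Hr Hbox]].
    assert (HVbox : forall z, box n (phi p) r z -> V z) by (intros z Hz; apply HVrho, Hbox, Hz).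
    (* In the chart, [h] moves each coordinate by less than [r / 2], and the target lies within
       [r / 2] of the centre of the box. Hence faces at distance [r] stay strictly on their side of
       the target. *)
    destruct (chart_modulus d n U V phi psi (phi p) r (r / 2)) as [e [He Hmod]]; try assumption; [lra|].
    destruct (HU _ HUp) as [s1 [Hs1 HUs]].
    destruct (Cphi p HUp (r / 2)) as [s2 [Hs2 Hphis]]; [lra|].
    exists e, (Rmin s1 s2). split; [exact He|]. split; [apply Rmin_pos; assumption|].
    intros q Hq h Ch Hh.
    assert (HUq : U q) by (apply HUs; eapply Rlt_le_trans; [exact Hq | apply Rmin_l]).
    assert (Hpq : dist_Rn n (phi p) (phi q) < r / 2).
    { apply Hphis; [exact HUq | eapply Rlt_le_trans; [exact Hq | apply Rmin_r]]. }
    destruct (poincare_miranda n (phi p) (phi q) r (fun z => phi (h (psi z)))) as [z [Hz Hzq]].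
    + exact Hr.
    + intros z i Hi Hz Hzi. destruct (Hmod z (h (psi z)) Hz (Hh _)) as [_ Hc].
      specialize (Hc i Hi). apply Rabs_def2 in Hc.
      pose proof (coord_dist_Rn_lt n _ _ i _ Hi Hpq). lra.
    + intros z i Hi Hz Hzi. destruct (Hmod z (h (psi z)) Hz (Hh _)) as [_ Hc].
      specialize (Hc i Hi). apply Rabs_def2 in Hc.
      pose proof (coord_dist_Rn_lt n _ _ i _ Hi Hpq). lra.
    + intros z Hz a Ha. destruct (Hmod z (h (psi z)) Hz (Hh _)) as [HUh _].
      destruct (Cphi _ HUh a Ha) as [b [Hb Hphib]].
      destruct (Ch (psi z) I b Hb) as [b' [Hb' Hhb]].
      destruct (Cpsi z (HVbox z Hz) b' Hb') as [b'' [Hb'' Hpsib]].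
      exists b''; split; [exact Hb''|]. intros w Hw Hzw. apply Hphib.
      * exact (proj1 (Hmod w (h (psi w)) Hw (Hh _))).
      * apply Hhb; [exact I|]. apply Hpsib; [apply HVbox, Hw | exact Hzw].
    + exists (psi z). destruct (Hmod z (h (psi z)) Hz (Hh _)) as [HUh _].
      rewrite <- (proj2 (Hphi _ HUh)), <- (proj2 (Hphi _ HUq)). f_equal; exact Hzq.
  - exists e; split; [exact He|]. intros h Ch Hh y. apply HP; assumption.
Qed.

(** For fixed [x], a point [y] is either [h x] or has a neighbourhood unrelated to all points near
    [x]. Compactness in [y] makes these radii uniform, which leaves [h x'] no place but near
    [h x]. *)
Lemma closed_graph_continuous {M : Type} (d : M -> M -> R) (G : M -> M -> Prop) (h : M -> M) :
  is_metric d -> compact_metric d ->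
  (forall x y, ~ G x y -> exists s, 0 < s /\
     forall x' y', d x x' < s -> d y y' < s -> ~ G x' y') ->
  (forall x, G x (h x)) -> (forall x y, G x y -> y = h x) ->
  continuous_on d d h (fun _ => True).
Proof.
  intros Hm Hcpt Hclosed HG Huniq x _ e He. pose proof Hm as [Hpos [Hd0 [Hsym Htri]]].
  destruct (compact_uniform d (fun r y => d (h x) y < e \/ forall x', d x x' < r -> ~ G x' y))
    as [r [Hr HP]]; try assumption.
  - intros r r' y Hr [H|H]; [left; exact H | right; intros x' Hx'; apply H; lra].
  - intros y. destruct (classic (G x y)) as [HGy|HGy].
    + exists 1, e; do 2 (split; [lra|]). intros y' Hy'. left.
      rewrite (Huniq _ _ HGy) in Hy'; exact Hy'.
    + destruct (Hclosed x y HGy) as [s [Hs H]]. exists s, s; do 2 (split; [exact Hs|]).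
      intros y' Hy'. right; intros x' Hx'; apply H; assumption.
  - exists r; split; [exact Hr|]. intros x' _ Hx'.
    destruct (HP (h x')) as [H|H]; [exact H|]. exfalso; exact (H x' Hx' (HG x')).
Qed.

(** * Integer iterates and expansivity *)

Lemma iterZ_succ {M : Type} (f finv : M -> M) :
  (forall x, finv (f x) = x) ->
  forall n x, iterZ f finv n (f x) = iterZ f finv (n + 1) x.
Proof.
  intros Hf n x. destruct n as [|p|p]; [reflexivity| |].
  - simpl. rewrite <- Nat.iter_succ_r. f_equal; lia.
  - destruct (Pos.eq_dec p 1) as [->|Hp]; [apply Hf|].
    replace (Z.neg p + 1)%Z with (Z.neg (Pos.pred p)) by lia. simpl.
    replace (Pos.to_nat p) with (S (Pos.to_nat (Pos.pred p))) by lia.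
    rewrite Nat.iter_succ_r, Hf; reflexivity.
Qed.

Lemma iterZ_pred {M : Type} (f finv : M -> M) :
  (forall x, finv (f x) = x) -> (forall x, f (finv x) = x) ->
  forall n x, iterZ f finv n (finv x) = iterZ f finv (n - 1) x.
Proof.
  intros H1 H2 n x. rewrite <- (H2 x) at 2. rewrite iterZ_succ by exact H1. f_equal; lia.
Qed.

Lemma iterZ_continuous {M : Type} (d : M -> M -> R) (f finv : M -> M) (n : Z) :
  is_homeo d f finv -> continuous_on d d (iterZ f finv n) (fun _ => True).
Proof.
  intros [_ [_ [Cf Cfinv]]].
  assert (Hiter : forall g, continuous_on d d g (fun _ => True) ->
            forall k, continuous_on d d (Nat.iter k g) (fun _ => True)).
  { intros g Cg k; induction k as [|k IH]; intros x _ e He.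
    - exists e; split; [exact He | intros y _ Hy; exact Hy].
    - simpl. destruct (Cg (Nat.iter k g x) I e He) as [e' [He' Hg]].
      destruct (IH x I e' He') as [s [Hs Hk]]. exists s; split; [exact Hs|].
      intros y _ Hy; apply Hg; [exact I | apply Hk; [exact I | exact Hy]]. }
  destruct n as [|p|p]; [apply (Hiter f Cf 0%nat) | apply Hiter, Cf | apply Hiter, Cfinv].
Qed.

Definition expansive {M : Type} (d : M -> M -> R) (f finv : M -> M) (a : R) : Prop :=
  forall x y, (forall n, d (iterZ f finv n x) (iterZ f finv n y) <= a) -> x = y.

(** Hyperbolicity bounds the distance of two points by [/ lam] times that of their images under [f]
    or [finv]. These image pairs also have orbits within [a] of each other, so the estimate iterates
    and the distance is at most [(/ lam) ^ m * a] for every [m]. *)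
Lemma hyperbolic_expansive {M : Type} (d : M -> M -> R) (f finv : M -> M) (del0 lam a : R) :
  is_metric d -> (forall x, finv (f x) = x) -> (forall x, f (finv x) = x) -> 1 < lam ->
  (forall x y, d x y < del0 -> Rmax (d (f x) (f y)) (d (finv x) (finv y)) >= lam * d x y) ->
  0 < a < del0 -> expansive d f finv a.
Proof.
  intros [Hpos [Hd0 _]] H1 H2 Hlam Hhyp Ha x y Hxy.
  assert (Hdecay : forall m x y,
    (forall n, d (iterZ f finv n x) (iterZ f finv n y) <= a) -> d x y <= (/ lam) ^ m * a).
  { clear x y Hxy; intros m; induction m as [|m IH]; intros x y Hxy.
    - simpl. specialize (Hxy 0%Z); simpl in Hxy; lra.
    - assert (Hf : d (f x) (f y) <= (/ lam) ^ m * a).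
      { apply IH; intros n; rewrite !iterZ_succ by assumption; apply Hxy. }
      assert (Hfinv : d (finv x) (finv y) <= (/ lam) ^ m * a).
      { apply IH; intros n; rewrite !iterZ_pred by assumption; apply Hxy. }
      specialize (Hxy 0%Z); simpl in Hxy.
      assert (Hmax := Hhyp x y ltac:(lra)).
      assert (Hle : lam * d x y <= (/ lam) ^ m * a).
      { eapply Rle_trans; [apply Rge_le, Hmax | apply Rmax_lub; assumption]. }
      simpl. apply Rmult_le_reg_l with lam; [lra|].
      replace (lam * (/ lam * (/ lam) ^ m * a)) with ((/ lam) ^ m * a) by (field; lra).
      exact Hle. }
  apply Hd0. apply Rle_antisym; [|apply Hpos]. apply Rnot_lt_le; intros Hlt.
  destruct (pow_lt_1_zero (/ lam)) with (y := d x y / a) as [N HN].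
  - rewrite Rabs_pos_eq by (left; apply Rinv_0_lt_compat; lra).
    rewrite <- Rinv_1; apply Rinv_lt_contravar; lra.
  - apply Rdiv_lt_0_compat; lra.
  - specialize (HN N (le_n _)). apply Rabs_def2 in HN.
    specialize (Hdecay N x y Hxy).
    assert ((/ lam) ^ N * a < d x y / a * a) by (apply Rmult_lt_compat_r; lra).
    replace (d x y / a * a) with (d x y) in * by (field; lra). lra.
Qed.

(** * The conjugacy defined by the shadowing relation *)

Section ShadowingConjugacy.
Variables (M : Type) (d : M -> M -> R) (f finv g ginv : M -> M) (e : R).
Hypothesis Hm : is_metric d.
Hypothesis Hcpt : compact_metric d.
Hypothesis Hf : is_homeo d f finv.
Hypothesis Hg : is_homeo d g ginv.
Hypothesis expf : expansive d f finv (2 * e).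
Hypothesis expg : expansive d g ginv (2 * e).

(** The bound is not strict, so that the relation is closed. *)
Definition shadows (y x : M) : Prop := forall n, d (iterZ f finv n y) (iterZ g ginv n x) <= e.

(** Shadowing fails at a single time [n], and the [n]-th iterates are continuous, so it still fails
    at that time for nearby points. *)
Lemma shadows_closed (x y : M) : ~ shadows y x ->
  exists s, 0 < s /\ forall x' y', d x x' < s -> d y y' < s -> ~ shadows y' x'.
Proof.
  destruct Hm as [Hpos [Hd0 [Hsym Htri]]]. intros Hn.
  apply not_all_ex_not in Hn as [n Hn]. apply Rnot_le_lt in Hn.
  set (t := (d (iterZ f finv n y) (iterZ g ginv n x) - e) / 2).
  assert (Ht : 0 < t) by (unfold t; lra).
  destruct (iterZ_continuous d f finv n Hf y I t Ht) as [s1 [Hs1 H1]].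
  destruct (iterZ_continuous d g ginv n Hg x I t Ht) as [s2 [Hs2 H2]].
  exists (Rmin s1 s2); split; [apply Rmin_pos; assumption|].
  intros x' y' Hx Hy Hs. specialize (Hs n).
  specialize (H1 y' I (Rlt_le_trans _ _ _ Hy (Rmin_l _ _))).
  specialize (H2 x' I (Rlt_le_trans _ _ _ Hx (Rmin_r _ _))).
  pose proof (Htri (iterZ f finv n y) (iterZ f finv n y') (iterZ g ginv n x)) as T1.
  pose proof (Htri (iterZ f finv n y') (iterZ g ginv n x') (iterZ g ginv n x)) as T2.
  rewrite (Hsym (iterZ g ginv n x') (iterZ g ginv n x)) in T2.
  unfold t in *; lra.
Qed.

(** Two orbits within [e] of a common one are within [2 * e] of each other, whence the expansivity
    constant. *)
Lemma shadows_unique_l (x y y' : M) : shadows y x -> shadows y' x -> y = y'.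
Proof.
  destruct Hm as [Hpos [Hd0 [Hsym Htri]]]. intros H H'. apply expf; intros n.
  specialize (H n); specialize (H' n).
  specialize (Htri (iterZ f finv n y) (iterZ g ginv n x) (iterZ f finv n y')).
  rewrite (Hsym (iterZ g ginv n x)) in Htri; lra.
Qed.

Lemma shadows_unique_r (x x' y : M) : shadows y x -> shadows y x' -> x = x'.
Proof.
  destruct Hm as [Hpos [Hd0 [Hsym Htri]]]. intros H H'. apply expg; intros n.
  specialize (H n); specialize (H' n).
  specialize (Htri (iterZ g ginv n x) (iterZ f finv n y) (iterZ g ginv n x')).
  rewrite (Hsym (iterZ g ginv n x) (iterZ f finv n y)) in Htri; lra.
Qed.

Lemma shadowing_conjugacy :
  (forall h, continuous_on d d h (fun _ => True) -> (forall x, d (h x) x <= e) ->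
     forall y, exists x, h x = y) ->
  (forall x, exists y, shadows y x) ->
  exists h hinv, is_homeo d h hinv /\ (forall x, f (h x) = h (g x)) /\
    (forall x, d (h x) x <= e) /\ (forall x, d (hinv x) x <= e).
Proof.
  intros Hsurj Hsh. pose proof Hm as [Hpos [Hd0 [Hsym Htri]]].
  destruct (choice_on _ Hsh) as [h Hh].
  assert (Ch : continuous_on d d h (fun _ => True)).
  { apply (closed_graph_continuous d (fun x y => shadows y x)); try assumption.
    - intros x y; apply shadows_closed.
    - intros x y Hy; apply (shadows_unique_l x); [exact Hy | apply Hh]. }
  assert (Hhx : forall x, d (h x) x <= e) by (intros x; exact (Hh x 0%Z)).
  destruct (choice_on _ (Hsurj h Ch Hhx)) as [hinv Hhinv].
  exists h, hinv.
  assert (Hinvh : forall x, hinv (h x) = x).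
  { intros x. apply (shadows_unique_r _ _ (h x)); [|apply Hh].
    rewrite <- (Hhinv (h x)) at 1. apply Hh. }
  split; [split; [exact Hinvh | split; [exact Hhinv | split; [exact Ch|]]]|].
  (* The graph of [hinv] is the same closed relation with its variables exchanged. *)
  - apply (closed_graph_continuous d shadows); try assumption.
    + intros y x Hn. destruct (shadows_closed x y Hn) as [s [Hs H]].
      exists s; split; [exact Hs | intros y' x' Hy Hx; apply H; assumption].
    + intros y. rewrite <- (Hhinv y) at 1. apply Hh.
    + intros y x Hyx. apply (shadows_unique_r _ _ y); [exact Hyx|].
      rewrite <- (Hhinv y) at 1. apply Hh.
  - split; [|split; [exact Hhx|]].
    (* Shifting time by one shows that [f (h x)] shadows [g x], as [h (g x)] does. *)
    + intros x. apply (shadows_unique_l (g x)); [|apply Hh]. intros n.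
      rewrite iterZ_succ by apply Hf. rewrite iterZ_succ by apply Hg. apply Hh.
    + intros x. rewrite Hsym. rewrite <- (Hhinv x) at 1. apply Hhx.
Qed.

End ShadowingConjugacy.

(** * Estimates for the C0 and Lipschitz distances, and structural stability *)

Lemma lub_of_nonneg (E : R -> Prop) (a : R) :
  is_lub E a -> (forall r, E r -> 0 <= r) -> 0 <= a /\ exists r, E r.
Proof.
  intros [Hub Hleast] Hpos.
  assert (Hex : exists r, E r).
  (* For an empty set, [a - 1] would be an upper bound below the least one. *)
  { apply NNPP; intros Hn. assert (a <= a - 1); [|lra].
    apply Hleast; intros r Hr; exfalso; apply Hn; exists r; exact Hr. }
  split; [|exact Hex]. destruct Hex as [r Hr].
  apply Rle_trans with r; [apply Hpos, Hr | apply Hub, Hr].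
Qed.

(** Each of the two suprema is at most [e], whence the factor 2; [x0] makes the sets nonempty, so
    that the suprema exist. *)
Lemma dC0_lt_id {M : Type} (d : M -> M -> R) (h hinv : M -> M) (x0 : M) (e eps : R) :
  (forall x, d (h x) x <= e) -> (forall x, d (hinv x) x <= e) -> 2 * e < eps ->
  dC0_lt d h hinv (fun x => x) (fun x => x) eps.
Proof.
  intros H1 H2 He.
  assert (Hlub : forall k : M -> M, (forall x, d (k x) x <= e) ->
    exists a, is_lub (fun r => exists x, r = d (k x) x) a /\ a <= e).
  { intros k Hk. destruct (completeness (fun r => exists x, r = d (k x) x)) as [a Ha].
    - exists e; intros r [x ->]; apply Hk.
    - exists (d (k x0) x0), x0; reflexivity.
    - exists a; split; [exact Ha|]. apply Ha; intros r [x ->]; apply Hk. }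
  destruct (Hlub h H1) as [a [Ha Hae]]. destruct (Hlub hinv H2) as [b [Hb Hbe]].
  exists a, b; split; [exact Ha | split; [exact Hb | lra]].
Qed.

(** Exponentiating the bound on the logarithm is legitimate because the left inverses make both maps
    injective, so the ratio is positive for distinct points. *)
Lemma logratio_lower {M : Type} (d : M -> M -> R) (f finv g ginv : M -> M) (c : R) :
  is_metric d -> (forall x, finv (f x) = x) -> (forall x, ginv (g x) = x) ->
  is_upper_bound (logratio_set d f g) c ->
  forall x y, exp (- c) * d (f x) (f y) <= d (g x) (g y).
Proof.
  intros [Hpos [Hd0 _]] Hf Hg Hc x y. destruct (classic (x = y)) as [<-|Hne].
  { rewrite !(proj2 (Hd0 _ _) eq_refl); lra. }
  assert (Hinj : forall k kinv : M -> M, (forall z, kinv (k z) = z) -> 0 < d (k x) (k y)).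
  { intros k kinv Hk. destruct (Hpos (k x) (k y)) as [H|H]; [exact H|].
    exfalso; apply Hne. symmetry in H; apply Hd0 in H. rewrite <- (Hk x), H; apply Hk. }
  pose proof (Hinj f finv Hf) as Pf; pose proof (Hinj g ginv Hg) as Pg.
  assert (Hln : ln (d (f x) (f y) / d (g x) (g y)) <= c).
  { eapply Rle_trans; [apply Rle_abs | apply Hc; exists x, y; split; [exact Hne | reflexivity]]. }
  assert (Hq : d (f x) (f y) / d (g x) (g y) <= exp c).
  { rewrite <- (exp_ln (d (f x) (f y) / d (g x) (g y))) by (apply Rdiv_lt_0_compat; assumption).
    destruct Hln as [Hln | ->]; [left; apply exp_increasing, Hln | right; reflexivity]. }
  rewrite exp_Ropp. pose proof (exp_pos c).
  apply Rmult_le_reg_l with (exp c / d (g x) (g y)); [apply Rdiv_lt_0_compat; assumption|].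
  replace (exp c / d (g x) (g y) * (/ exp c * d (f x) (f y)))
    with (d (f x) (f y) / d (g x) (g y)) by (field; lra).
  replace (exp c / d (g x) (g y) * d (g x) (g y)) with (exp c) by (field; lra). exact Hq.
Qed.

Theorem mainTheorem8 (M : Type) (d : M -> M -> R) (f finv : M -> M) :
  is_metric d ->
  compact_metric d ->
  (exists n : nat, manifold_without_boundary d n) ->
  bi_lipschitz_homeo d f finv ->
  f_hyperbolic d f finv ->
  (persistent d f finv \/ weak_shadowing d f finv) ->
  lipschitz_structurally_stable d f finv.
Proof.
  intros Hm Hcpt [n Hman] [Hf _] [del0 [lam [Hdel0 [Hlam Hhyp]]]] Hps eps Heps.
  pose proof Hm as [Hpos [Hd0 [Hsym Htri]]].
  destruct (near_identity_surjective d n Hm Hcpt Hman) as [e0 [He0 Hsurj]].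
  (* The three bounds ensure [2 * e < eps] for the final estimate, [2 * e < del0] for expansivity,
     and [e < e0] for surjectivity. *)
  set (e := Rmin (eps / 3) (Rmin (del0 / 3) (e0 / 2))).
  assert (He : 0 < e) by (repeat apply Rmin_pos; lra).
  assert (Hle : e <= eps / 3 /\ e <= del0 / 3 /\ e <= e0 / 2).
  { unfold e; split; [apply Rmin_l | split].
    - eapply Rle_trans; [apply Rmin_r | apply Rmin_l].
    - eapply Rle_trans; [apply Rmin_r | apply Rmin_r]. }
  (* Weak shadowing gives the first alternative, persistence the second, where [f] and [g] exchange
     roles. *)
  assert (Hdel1 : exists del1, 0 < del1 /\ forall g ginv, is_homeo d g ginv ->
    dC0_lt d f finv g ginv del1 ->
    (forall x, exists y, shadows M d f finv g ginv e y x) \/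
    (forall x, exists y, shadows M d g ginv f finv e y x)).
  { destruct Hps as [Hp|Hw]; [destruct (Hp e He) as [del1 [Hdel1 H]] | destruct (Hw e He) as [del1 [Hdel1 H]]];
      exists del1; (split; [exact Hdel1|]); intros g ginv Hg HC0; [right | left];
      intros x; destruct (H g ginv Hg HC0 x) as [y Hy]; exists y; intros k; left;
      [rewrite Hsym|]; apply Hy. }
  destruct Hdel1 as [del1 [Hdel1 Hshadow]].
  assert (Hlnlam : 0 < ln lam) by (rewrite <- ln_1; apply ln_increasing; lra).
  (* Log-ratios below [ln lam] cannot use up the expansion factor [lam]. *)
  exists (Rmin del1 (ln lam)); split; [apply Rmin_pos; assumption|].
  intros g ginv [Hg _] [a [b [c [c' [Ha [Hb [Hc [Hc' Hsum]]]]]]]].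
  destruct (lub_of_nonneg _ _ Ha) as [Ha0 [_ [x0 _]]]; [intros r [x ->]; apply Hpos|].
  destruct (lub_of_nonneg _ _ Hb) as [Hb0 _]; [intros r [x ->]; apply Hpos|].
  destruct (lub_of_nonneg _ _ Hc) as [Hc0 _];
    [intros r [x [y [_ ->]]]; apply Rabs_pos|].
  destruct (lub_of_nonneg _ _ Hc') as [Hc'0 _];
    [intros r [x [y [_ ->]]]; apply Rabs_pos|].
  assert (Hsum1 : a + b + c + c' < del1) by (eapply Rlt_le_trans; [exact Hsum | apply Rmin_l]).
  assert (Hsum2 : a + b + c + c' < ln lam) by (eapply Rlt_le_trans; [exact Hsum | apply Rmin_r]).
  assert (expf : expansive d f finv (2 * e)).
  { apply hyperbolic_expansive with del0 lam; try assumption; [apply Hf | apply Hf | lra]. }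
  assert (expg : expansive d g ginv (2 * e)).
  (* Distances of images under [g] and [ginv] are at least [exp (- t)] times those under [f] and
     [finv], so [g] is hyperbolic with the same [del0] and the factor [exp (- t) * lam], which
     exceeds 1. *)
  { set (t := Rmax c c').
    assert (Ht : t < ln lam) by (apply Rmax_lub_lt; lra).
    apply hyperbolic_expansive with del0 (exp (- t) * lam); try assumption;
      [apply Hg | apply Hg | | | lra].
    - rewrite exp_Ropp, <- (exp_ln lam) by lra.
      apply Rmult_lt_reg_l with (exp t); [apply exp_pos|].
      rewrite <- Rmult_assoc, Rinv_r by (pose proof (exp_pos t); lra).
      rewrite Rmult_1_l, Rmult_1_r. apply exp_increasing, Ht.
    - intros x y Hxy. apply Rle_ge.
      assert (Hub : is_upper_bound (logratio_set d f g) t).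
      { intros r Hr; eapply Rle_trans; [apply Hc, Hr | apply Rmax_l]. }
      assert (Hub' : is_upper_bound (logratio_set d finv ginv) t).
      { intros r Hr; eapply Rle_trans; [apply Hc', Hr | apply Rmax_r]. }
      pose proof (logratio_lower d f finv g ginv t Hm (proj1 Hf) (proj1 Hg) Hub x y) as L1.
      pose proof (logratio_lower d finv f ginv g t Hm (proj1 (proj2 Hf)) (proj1 (proj2 Hg)) Hub' x y) as L2.
      specialize (Hhyp x y Hxy). pose proof (exp_pos (- t)) as Ht0.
      apply Rle_trans with (exp (- t) * Rmax (d (f x) (f y)) (d (finv x) (finv y))).
      + rewrite Rmult_assoc. apply Rmult_le_compat_l; lra.
      + rewrite <- RmaxRmult by lra. apply Rmax_Rle. unfold Rmax; destruct (Rle_dec _ _); [right | left]; lra. }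
  assert (Hsurj' : forall h, continuous_on d d h (fun _ => True) -> (forall x, d (h x) x <= e) ->
            forall y, exists x, h x = y).
  { intros h Ch Hh. apply Hsurj; [exact Ch|]. intros x; specialize (Hh x); lra. }
  destruct (Hshadow g ginv Hg) as [Hsh|Hsh].
  { exists a, b; split; [exact Ha | split; [exact Hb | lra]]. }
  - destruct (shadowing_conjugacy M d f finv g ginv e) as [h [hinv [Hh [Hconj [H1 H2]]]]]; try assumption.
    exists h, hinv; split; [exact Hh | split; [exact Hconj|]].
    apply (dC0_lt_id d h hinv x0 e); try assumption; lra.
  (* Here [k] satisfies [g (k x) = k (f x)], so the required conjugacy is its inverse. *)
  - destruct (shadowing_conjugacy M d g ginv f finv e) as [k [kinv [Hk [Hconj [H1 H2]]]]]; try assumption.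
    destruct Hk as [K1 [K2 [K3 K4]]].
    exists kinv, k; split; [split; [exact K2 | split; [exact K1 | split; assumption]] | split].
    + intros x. rewrite <- (K1 (f (kinv x))), <- Hconj, K2; reflexivity.
    + apply (dC0_lt_id d kinv k x0 e); try assumption; lra.
Qed.
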